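(* Let $\Omega\subset\mathbb R^n$ be compact, convex, full dimensional, with boundary of class $C^1$, and let $\bar\tau\in(0,1)$ be the fixed constant used in the definition of the Short Orthographic Retractions (SOR) method. Then $\mathrm{SB}_{\mathrm{SOR}}(\Omega)\ge\bar\tau$.
   Context: $T_\Omega(x)$, $N_\Omega(x)$ are the tangent and normal cones of $\Omega$ at $x$, $\pi(C,\cdot)$ is the Euclidean projection on $C$, $\pi_x(g)=\|\pi(T_\Omega(x),g)\|$. Orthographic retraction. For $x\in\partial\Omega$, $J(x)$ is the (unit) outward pointing normal and $T_x\Omega$ the tangent hyperplane to $\partial\Omega$ at $x$ (as a linear subspace of directions). For $u\in T_x\Omega$ (when defined, in particular for $\|u\|$ small), $P(x,u)$ is the first intersection between $\Omega$ and the line through $x+u$ with direction $-J(x)$, i.e. $P(x,u)=x+u-\gamma J(x)$ with $\gamma\ge0$ minimal such that this point is in $\Omega$. For $g\in\mathbb R^n$, $g=g_J(x)+g_\Omega(x)$ is the decomposition of $g$ in its components along $J(x)$ and $T_x\Omega$. SOR method. Let $\bar T(\Omega)=\{(x,g)\in\partial\Omega\times\mathbb R^n: g\notin\mathrm{int}(T_\Omega(x))\cup N_\Omega(x)\}$. For $(x,g)\in\bar T(\Omega)$ the shrinking coefficient is $$\bar\nu(x,g)=\sup\Big\{\lambda\in\mathbb R_{\ge0}:\ \frac{\langle g,P(x,\lambda g_\Omega(x))-x\rangle}{\pi_x(g)\,\|P(x,\lambda g_\Omega(x))-x\|}\ge\bar\tau\Big\}$$ (over $\lambda$ for which the quotient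 is defined), which is positive. The set of directions is $\mathrm{SOR}(x,g)=\{g\}$ if $g\in\mathrm{int}(T_\Omega(x))$ (in particular for every $x\in\mathrm{int}(\Omega)$); $\mathrm{SOR}(x,g)=\{P(x,\lambda g_\Omega(x))-x:\ \lambda\in(0,\bar\nu(x,g)]\}$ if $(x,g)\in\bar T(\Omega)$; and $\mathrm{SOR}(x,g)=\{0\}$ if $\pi_x(g)=0$. Slope bound. $\mathrm{DSB}_{\mathrm{SOR}}(\Omega,x,g)=\inf_{d\in\mathrm{SOR}(x,g)}\frac{\langle g,d\rangle}{\pi_x(g)\|d\|}$ if $\pi_x(g)\neq0$ and $=1$ otherwise; $\mathrm{SB}_{\mathrm{SOR}}(\Omega)=\inf_{x\in\Omega,g\in\mathbb R^n}\mathrm{DSB}_{\mathrm{SOR}}(\Omega,x,g)$. *)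

(* Defs.v *)
From HB Require Import structures.
From mathcomp Require Import all_boot all_order all_algebra.
From mathcomp Require Import all_classical all_reals all_analysis.

Set Implicit Arguments.
Unset Strict Implicit.
Unset Printing Implicit Defensive.

Import Order.TTheory GRing.Theory Num.Theory.
Import numFieldNormedType.Exports.

Local Open Scope classical_set_scope.
Local Open Scope ring_scope.

Section Euclidean.
Context {R : realType} {n : nat}.
Implicit Types (x y u v g p q : 'rV[R]_n) (C : set 'rV[R]_n).

Definition dotv u v : R := \sum_(i < n) u 0 i * v 0 i.

(* The library norm on 'rV[R]_n is the sup norm; it is used only through the
   topology it induces. *)
Definition enorm u : R := Num.sqrt (dotv u u).

(* Euclidean projection; meant for nonempty closed convex C, where the
   minimizer exists and is unique. *)
Definition proj C g : 'rV[R]_n :=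
  xget 0 [set p | C p /\ forall q, C q -> enorm (g - p) <= enorm (g - q)].

End Euclidean.

Section Geometry.
Context {R : realType} {n : nat}.
Variable Omega : set 'rV[R]_n.
Implicit Types (x y u v g p q d j : 'rV[R]_n) (U : set 'rV[R]_n).

Definition boundary : set 'rV[R]_n := closure Omega `\` interior Omega.

(* Tangent and normal cones in the sense of convex analysis. *)
Definition tangent_cone x : set 'rV[R]_n :=
  closure [set v | exists t y, [/\ 0 <= t, Omega y & v = t *: (y - x)]].

Definition normal_cone x : set 'rV[R]_n :=
  [set v | forall y, Omega y -> dotv v (y - x) <= 0].

Definition pi_norm x g : R := enorm (proj (tangent_cone x) g).

Definition C1_on U (phi : 'rV[R]_n -> R) : Prop :=
  forall y, U y -> differentiable phi y /\
    forall v, {for y, continuous (fun z => 'd phi z v)}.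

(* Near x, the boundary is the zero set of a C^1 function whose differential
   at x does not vanish. *)
Definition local_equation x U (phi : 'rV[R]_n -> R) : Prop :=
  [/\ open U /\ U x,
      C1_on U phi,
      exists v, 'd phi x v != 0
    & forall y, U y -> (boundary y <-> phi y = 0)].

Definition C1_boundary : Prop :=
  forall x, boundary x -> exists U phi, local_equation x U phi.

(* Tangent hyperplane to the boundary, as a linear subspace of directions. *)
Definition tangent_hyperplane x : set 'rV[R]_n :=
  [set v | exists U phi, local_equation x U phi /\ 'd phi x v = 0].

(* Unit, orthogonal to the boundary, and leaving Omega. *)
Definition is_outward_normal x j : Prop :=
  [/\ enorm j = 1,
      forall v, tangent_hyperplane x v -> dotv j v = 0
    & \forall t \near 0^'+, ~ Omega (x + t *: j)].

Definition outward_normal x : 'rV[R]_n := xget 0 (is_outward_normal x).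

Definition normal_part x g : 'rV[R]_n :=
  dotv g (outward_normal x) *: outward_normal x.

Definition tangent_part x g : 'rV[R]_n := g - normal_part x g.

Definition is_retraction x u p : Prop :=
  exists gamma : R,
    [/\ 0 <= gamma, p = x + u - gamma *: outward_normal x, Omega p
      & forall gamma', 0 <= gamma' ->
          Omega (x + u - gamma' *: outward_normal x) -> gamma <= gamma'].

Definition retraction_defined x u : Prop := exists p, is_retraction x u p.

(* Where the retraction is undefined the value x gives a null direction, hence
   a slope 0 < tau: the default value can only invalidate a slope bound. *)
Definition retraction x u : 'rV[R]_n := xget x (is_retraction x u).

Definition slope x g d : R := dotv g d / (pi_norm x g * enorm d).

Definition Tbar x g : Prop :=
  boundary x /\ ~ (interior (tangent_cone x) `|` normal_cone x) g.

Section SOR.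
Variable tau : R.

Definition sor_dir x g (lambda : R) : 'rV[R]_n :=
  retraction x (lambda *: tangent_part x g) - x.

(* The slope quotient is defined when the retraction is and its denominator is
   nonzero; the latter means sor_dir != 0, since pi_norm x g != 0 on Tbar. *)
Definition nubar x g : R :=
  sup [set lambda | [/\ 0 <= lambda,
                        retraction_defined x (lambda *: tangent_part x g),
                        pi_norm x g * enorm (sor_dir x g lambda) != 0
                      & tau <= slope x g (sor_dir x g lambda)]].

Definition SOR_set x g : set 'rV[R]_n :=
  [set d | [\/ interior (tangent_cone x) g /\ d = g,
               Tbar x g /\ exists lambda, 0 < lambda <= nubar x g /\
                                          d = sor_dir x g lambda
             | pi_norm x g = 0 /\ d = 0]].

(* The real-valued inf and sup are 0 on sets that are empty or unbounded, so a
   positive lower bound on these infima also entails that they are genuine. *)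
Definition DSB x g : R :=
  if pi_norm x g != 0 then inf [set slope x g d | d in SOR_set x g] else 1.

Definition SB : R := inf [set DSB x g | x in Omega & g in [set: 'rV[R]_n]].

End SOR.
End Geometry.

(* Main.v *)
Require Import Defs.
From mathcomp Require Import all_boot all_order all_algebra.
From mathcomp Require Import all_classical all_reals all_analysis.
From mathcomp Require Import ring lra.
Import Order.TTheory GRing.Theory Num.Theory.
Import numFieldNormedType.Exports.
Local Open Scope classical_set_scope.
Local Open Scope ring_scope.

(** At a boundary point [x] let [j] be the outward unit normal, [h = <g, j>]
and [u] the tangential part of [g].

Smoothness enters through one fact ([outward_normalP]): the cone of feasible
directions at [x] contains the open half-space [<j, v> < 0] and lies in the
closed one. Hence the tangent cone is the closed half-space. If [g] is interior
to it then [g] is its own projection and its slope is 1. Otherwise [h >= 0], the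
projection of [g] is [u], and [pi_norm x g = |u|], which vanishes only on the
normal cone.

In the remaining case every retraction step has the form
[d = lam u - gam j] with [lam, gam >= 0], and the slope condition reads
[<g, d> >= tau |u| |d|], where [<g, d> = lam |u|^2 - gam h] and
[|d|^2 = lam^2 |u|^2 + gam^2]. Call [(lam, gam)] admissible when
[x + d] is in [Omega] and this condition holds, without asking that [gam] be
least. Admissible pairs
- contain, at the lengths [lam > 0] they use, the actual retraction, since
  decreasing [gam] increases [<g, d>] and decreases [|d|]
  ([admissible_slope], with the converse [slope_admissible]);
- are stable under shrinking, by convexity ([admissible_scale]);
- include one with [lam > 0], by smoothness ([admissible_positive]);
- attain a greatest [lam], by compactness ([admissible_max]).
So the admissible [lam] fill an interval [[0, lamM]] with [lamM > 0], the
supremum defining the shrinking coefficient is over [(0, lamM]], and every step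
length up to that coefficient satisfies the slope bound.

The half-space fact comes from a local equation [phi = 0] of the boundary. If
[dphi k = 0], then [phi] has opposite signs at [x + t (k + e w)] and
[x + t (k - e w)] for small [t], so by the intermediate value theorem the
boundary contains points in directions arbitrarily close to [k]
([boundary_tangent]). Therefore no interior point lies in a direction of
[ker dphi], which puts [Omega] on one side of [x + ker dphi]
([interior_side]), and convex combinations of such boundary points with interior
points fill the open half-space ([feasible_side]). *)

Set Implicit Arguments.
Unset Strict Implicit.
Unset Printing Implicit Defensive.

(** * Euclidean geometry of row vectors *)

Section EuclideanSpace.
Context {R : realType} {n : nat}.
Implicit Types (u v w g p q : 'rV[R]_n) (a : R).

Lemma dotvC u v : dotv u v = dotv v u.
Proof. by apply: eq_bigr => i _; rewrite mulrC. Qed.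

Lemma dotvDr u v w : dotv u (v + w) = dotv u v + dotv u w.
Proof. by rewrite -big_split; apply: eq_bigr => i _; rewrite mxE mulrDr. Qed.

Lemma dotvZr a u v : dotv u (a *: v) = a * dotv u v.
Proof. by rewrite mulr_sumr; apply: eq_bigr => i _; rewrite mxE mulrCA. Qed.

Lemma dotvNr u v : dotv u (- v) = - dotv u v.
Proof. by rewrite -scaleN1r dotvZr mulN1r. Qed.

Lemma dotvDl u v w : dotv (v + w) u = dotv v u + dotv w u.
Proof. by rewrite dotvC dotvDr !(dotvC u). Qed.

Lemma dotvZl a u v : dotv (a *: v) u = a * dotv v u.
Proof. by rewrite dotvC dotvZr dotvC. Qed.

Lemma dotvNl u v : dotv (- v) u = - dotv v u.
Proof. by rewrite dotvC dotvNr dotvC. Qed.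

Lemma dotv0r u : dotv u 0 = 0.
Proof. by rewrite -(scale0r u) dotvZr mul0r. Qed.

Definition dotvE := (dotvDr, dotvDl, dotvZr, dotvZl, dotvNr, dotvNl).

Lemma dotv_ge0 u : 0 <= dotv u u.
Proof. by apply: sumr_ge0 => i _; exact: sqr_ge0. Qed.

Lemma dotv_eq0 u : (dotv u u == 0) = (u == 0).
Proof.
apply/eqP/eqP => [|->]; last exact: dotv0r.
move/psumr_eq0P => u0; apply/rowP => i; rewrite mxE; apply/eqP.
by rewrite -sqrf_eq0 expr2 u0// => j _; exact: sqr_ge0.
Qed.

Lemma enorm_ge0 u : 0 <= enorm u.
Proof. exact: sqrtr_ge0. Qed.

Lemma enorm_sq u : enorm u ^+ 2 = dotv u u.
Proof. exact/sqr_sqrtr/dotv_ge0. Qed.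

Lemma enorm_eq0 u : (enorm u == 0) = (u == 0).
Proof. by rewrite -dotv_eq0 -enorm_sq sqrf_eq0. Qed.

Lemma enorm_le u v : (enorm u <= enorm v) = (dotv u u <= dotv v v).
Proof. by rewrite ler_sqrt// dotv_ge0. Qed.

Lemma enormZ a u : 0 <= a -> enorm (a *: u) = a * enorm u.
Proof.
move=> a0; rewrite /enorm !dotvE mulrA -expr2 sqrtrM ?sqr_ge0//.
by rewrite sqrtr_sqr ger0_norm.
Qed.

Lemma dotv_continuous u : continuous (dotv u).
Proof.
apply: (continuous_big (op := +%R) (x0 := 0)) => [|i _ v].
  exact: (@add_continuous R).
by apply: (@continuousM R); [exact: cst_continuous|exact: coord_continuous].
Qed.

Lemma enorm_continuous : continuous (@enorm R n).
Proof.
move=> u; apply: continuous_comp; last exact: sqrt_continuous.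
apply: (continuous_big (op := +%R) (x0 := 0)) u => [|i _ v].
  exact: (@add_continuous R).
by apply: (@continuousM R); exact: coord_continuous.
Qed.

Lemma line_continuous p v : continuous (fun s : R => p + s *: v).
Proof.
move=> s; apply: (@continuousD R 'rV[R]_n R (cst p) (fun s => s *: v)).
  exact: cst_continuous.
by apply: (@continuousZr_tmp R 'rV[R]_n R idfun); exact: cvg_id.
Qed.

Lemma translation_continuous q : continuous (fun v => v - q).
Proof.
move=> v; apply: (@continuousB R 'rV[R]_n 'rV[R]_n idfun (cst q)).
  exact: cvg_id.
exact: cst_continuous.
Qed.

Lemma homothety_continuous p q a : continuous (fun v => p + a *: (v - q)).
Proof.
move=> v.
apply: (@continuousD R 'rV[R]_n 'rV[R]_n (cst p) (fun v => a *: (v - q))).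
  exact: cst_continuous.
apply: (@continuousZl_tmp R 'rV[R]_n 'rV[R]_n (fun v => v - q)).
exact: translation_continuous.
Qed.

(** The cross term in the expansion of [|g - q|^2] around [p] is nonnegative, so
[p] is a minimiser and any other minimiser is at distance 0 from it: the choice
made by [proj] can only be [p]. *)
Lemma projE (C : set 'rV[R]_n) g p :
  C p -> (forall q, C q -> dotv (g - p) (q - p) <= 0) -> Defs.proj C g = p.
Proof.
move=> Cp var; rewrite /Defs.proj.
have split q : dotv (g - q) (g - q) = dotv (g - p) (g - p)
    - 2 * dotv (g - p) (q - p) + dotv (q - p) (q - p).
  by rewrite !dotvE (dotvC q g) (dotvC p g) (dotvC q p); ring.
have minp : forall q, C q -> enorm (g - p) <= enorm (g - q).
  move=> q Cq; rewrite enorm_le (split q).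
  by have := var _ Cq; have := dotv_ge0 (q - p); lra.
case: xgetP => [q _ [Cq minq]|/(_ p)[]//].
apply/eqP; rewrite -subr_eq0 -dotv_eq0 eq_le dotv_ge0 andbT.
by have := minq _ Cp; rewrite enorm_le (split q); have := var _ Cq; lra.
Qed.

Lemma orthogonal_hyperplane u v : dotv u u = 1 ->
  (forall w, dotv u w = 0 -> dotv v w = 0) -> v = dotv u v *: u.
Proof.
move=> u1 vP; apply/eqP; rewrite -subr_eq0 -dotv_eq0.
set r := v - _.
have ur : dotv u r = 0 by rewrite /r !dotvE u1; ring.
by rewrite {1}/r dotvDl vP// dotvNl dotvZl ur mulr0 oppr0 addr0.
Qed.

Lemma linear_dotv (f : {linear 'rV[R]_n -> R}) v :
  f v = dotv (\row_i f 'e_i) v.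
Proof.
rewrite [in LHS](row_sum_delta v) linear_sum; apply: eq_bigr => i _.
by rewrite linearZ/= mxE mulrC.
Qed.

End EuclideanSpace.

(** * Smooth boundary points of a convex body *)

Section Convexity.
Context {R : realType} {n : nat}.
Variable Omega : set 'rV[R]_n.
Hypothesis Omega_convex : convex_set Omega.
Implicit Types (x y z u v w : 'rV[R]_n).

Lemma convex_segment x y (t : R) : Omega x -> Omega y -> 0 <= t <= 1 ->
  Omega (x + t *: (y - x)).
Proof.
move=> Ox Oy /andP[t0 t1].
have := Omega_convex (Itv01 t0 t1) (mem_set Oy) (mem_set Ox).
rewrite inE => /=; congr Omega.
by apply/rowP => i; rewrite !mxE/= /unstable.onem; ring.
Qed.

Lemma interior_segment x z (t : R) :
  Omega x -> interior Omega z -> 0 < t <= 1 ->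
  interior Omega (x + t *: (z - x)).
Proof.
move=> Ox Oz /andP[t0 t1].
pose f y := x + t^-1 *: (y - x).
have fz : f (x + t *: (z - x)) = z.
  by apply/rowP => i; rewrite !mxE; field; rewrite gt_eqF.
have := @homothety_continuous R n x x t^-1 (x + t *: (z - x)) Omega.
rewrite -/(f _) fz => /(_ Oz).
apply: (@filterS _ _ (nbhs_filter (x + t *: (z - x)))) => y /= Ofy.
have -> : y = x + t *: (f y - x).
  by apply/rowP => i; rewrite !mxE; field; rewrite gt_eqF.
by apply: convex_segment; rewrite // (ltW t0).
Qed.

Lemma open_line (U : set 'rV[R]_n) z w : nbhs z U ->
  exists2 e : R, 0 < e & forall s, `|s| <= e -> U (z + s *: w).
Proof.
move=> Uz.
have : \forall s \near (0 : R), U (z + s *: w).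
  by apply: (@line_continuous _ _ z w); rewrite scale0r addr0.
move=> /nbhs_ballP[e /= e0 eU]; exists (e / 2); first exact: divr_gt0.
move=> s se; apply: eU; rewrite /ball/= sub0r normrN.
by apply: le_lt_trans se _; rewrite ltr_pdivrMr// ltr_pMr// ltr1n.
Qed.

End Convexity.

Lemma positive_along {R : realType} {n : nat} (psi : 'rV[R]_n -> R) x v :
  differentiable psi x -> psi x = 0 -> 0 < 'd psi x v ->
  \forall t \near (0 : R)^'+, 0 < psi (x + t *: v).
Proof.
move=> psi_diff psix dv.
have := @diff_derivable _ _ _ psi x v psi_diff.
rewrite -(deriveE _ psi_diff) in dv.
move=> /cvg_dnbhs_at_right/cvgr_gt/(_ _ dv); rewrite psix.
move=> dpos; near=> t.
have t0 : 0 < t by near: t; exact: nbhs_right_gt.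
rewrite -(pmulr_rgt0 _ (_ : 0 < t^-1)) ?invr_gt0//.
have : 0 < t^-1 *: ((psi \o shift x) (t *: v) - 0) by near: t; exact: dpos.
by rewrite /= subr0 addrC.
Unshelve. all: by end_near. Qed.

Lemma sign_change {R : realType} (a b : R) : a * b < 0 ->
  exists2 t, 0 < t <= 1 & (1 - t) * b + t * a = 0.
Proof.
move=> ab; have ba : b - a != 0.
  by apply: contraTneq ab => /subr0_eq ->; rewrite -leNgt -expr2 sqr_ge0.
exists (b / (b - a)); last by field.
have ba2 : 0 < (b - a) ^+ 2 by rewrite exprn_even_gt0.
have bb := sqr_ge0 b; have aa := sqr_ge0 a; rewrite expr2 in aa bb.
rewrite (_ : b / (b - a) = b * (b - a) / (b - a) ^+ 2); last by field.
by rewrite divr_gt0//= ?ler_pdivrMr// ?expr2; move: ab; lra.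
Qed.

Section LocalEquation.
Context {R : realType} {n : nat}.
Variables (Omega : set 'rV[R]_n) (x : 'rV[R]_n).
Variables (U : set 'rV[R]_n) (phi : 'rV[R]_n -> R).
Hypothesis phiP : local_equation Omega x U phi.
Hypothesis bx : boundary Omega x.
Implicit Types (y z u v w k : 'rV[R]_n).

Let phix : phi x = 0.
Proof. by case: phiP => -[_ Ux] _ _ /(_ _ Ux)[+ _]; exact. Qed.

Let phi_diff : differentiable phi x.
Proof. by case: phiP => -[_ Ux] /(_ _ Ux)[]. Qed.

(** Moving the direction [k] slightly towards [±w] makes [phi] change sign, so
an intermediate value of [s] hits the boundary: the boundary is tangent to the
kernel of [dphi] at [x]. *)
Lemma boundary_tangent k w (e : R) : 'd phi x k = 0 -> 'd phi x w != 0 ->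
  0 < e -> exists t s : R,
  [/\ 0 < t < 1, `|s| <= e & boundary Omega (x + t *: (k + s *: w))].
Proof.
move=> dk dw0 e0; wlog dw : w dw0 / 0 < 'd phi x w => [wlg|].
  case: (ltP 0 ('d phi x w)) => [|dw]; first exact: wlg.
  have [||t [s [t01 se bts]]] := wlg (- w).
  - by rewrite linearN oppr_eq0.
  - by rewrite linearN oppr_gt0 lt_neqAle dw0.
  by exists t, (- s); rewrite normrN scaleNr -scalerN.
have up : 0 < 'd phi x (k + e *: w).
  by rewrite linearD linearZ/= dk add0r mulr_gt0.
have down : 'd phi x (k + (- e) *: w) < 0.
  by rewrite linearD linearZ/= dk add0r nmulr_rlt0// oppr_lt0.
have pos_dir := positive_along phi_diff phix up.
have neg_dir : \forall t \near (0 : R)^'+, phi (x + t *: (k + (- e) *: w)) < 0.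
  have Nphi_diff : differentiable (- phi) x by exact: differentiableN.
  have := positive_along (v := k + (- e) *: w) Nphi_diff.
  rewrite diffN// !fctE phix oppr0 => /(_ erefl).
  rewrite oppr_gt0 => /(_ down); apply: filterS => t.
  by rewrite oppr_gt0.
case: phiP => -[oU Ux] phi1 _ bP.
have /nbhs_ballP[r /= r0 rU] : nbhs x U by exact: open_nbhs_nbhs.
(* [M] bounds the direction [k + s w] for all [|s| <= e]; adding 1 makes it
   positive. *)
pose M := `|k| + e * `|w| + 1.
have M0 : 0 < M by rewrite /M ltr_wpDl// addr_ge0// mulr_ge0// ltW.
suff : \forall t \near (0 : R)^'+, exists s : R,
    [/\ 0 < t < 1, `|s| <= e & boundary Omega (x + t *: (k + s *: w))].
  by move=> /filter_ex[t [s ?]]; exists t, s.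
near=> t.
have t0 : 0 < t by near: t; exact: nbhs_right_gt.
have t1 : t < 1 by near: t; exact: nbhs_right_lt.
have tr : t < r / M by near: t; apply: nbhs_right_lt; exact: divr_gt0.
have tU s : `|s| <= e -> U (x + t *: (k + s *: w)).
  move=> se; apply: rU; rewrite -ball_normE /ball_/= opprD addNKr normrN normrZ.
  rewrite gtr0_norm//; apply: (@le_lt_trans _ _ (t * M)).
    rewrite ler_pM2l// /M.
    rewrite (le_trans (ler_normD _ _))// normrZ.
    by rewrite ler_wpDr// lerD2l ler_wpM2r.
  by rewrite -ltr_pdivlMr.
pose f s := phi (x + t *: (k + s *: w)).
have fc : {within `[- e, e], continuous f}.
  apply: continuous_in_subspaceT => s; rewrite inE/= in_itv/= -ler_norml => se.
  apply: (@continuous_comp R 'rV[R]_n R (fun s => x + t *: (k + s *: w)) phi).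
    rewrite (_ : (fun s => _) = fun s => x + t *: k + s *: (t *: w)).
      exact: line_continuous.
    by apply/funext => r'; rewrite scalerDr addrA !scalerA mulrC.
  by apply: differentiable_continuous; case: (phi1 _ (tU _ se)).
have f0 : f (- e) < 0 < f e.
  by rewrite /f; apply/andP; split; near: t; [exact: neg_dir|exact: pos_dir].
have [||s] := @IVT R f (- e) e 0 _ fc.
- by rewrite (@le_trans _ _ 0)// ?oppr_le0 ltW.
- by case/andP: f0 => f1 f2; rewrite ge_min le_max (ltW f1) (ltW f2) orbT.
rewrite in_itv/= -ler_norml => se fs0.
by exists s; rewrite t0 t1; split=> //; apply/bP => //; exact: tU.
Unshelve. all: by end_near. Qed.

Hypothesis Omega_convex : convex_set Omega.
Hypothesis Ox : Omega x.
Hypothesis bO : boundary Omega `<=` Omega.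

Let dphi_comb (p q : R) u v :
  'd phi x (p *: u + q *: v) = p * 'd phi x u + q * 'd phi x v.
Proof. by rewrite linearD linearZ [in LHS]linearZ. Qed.

(** Were [z - x] tangent, [boundary_tangent] would give a boundary point on the
open segment from [x] to a point near [z], all of which is interior. *)
Lemma interior_transverse z : interior Omega z -> 'd phi x (z - x) != 0.
Proof.
move=> Oz; apply/negP => /eqP dz.
case: phiP => _ _ [w dw] _.
have nz : nbhs z (interior Omega).
  by apply: open_nbhs_nbhs; split=> //; exact: open_interior.
have [e e0 eO] := open_line w nz.
have [t [s [/andP[t0 t1] se []]]] := boundary_tangent dz dw e0.
move=> _; apply.
rewrite (_ : z - x + s *: w = z + s *: w - x); last by rewrite addrAC.
by apply: interior_segment => //; [exact: eO|rewrite t0 ltW].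
Qed.

(** The sign of [dphi] is constant on the directions towards interior points,
as a segment joining two opposite signs would contain an interior point in a
tangent direction. *)
Lemma interior_side z y : interior Omega z -> Omega y ->
  0 <= 'd phi x (z - x) * 'd phi x (y - x).
Proof.
move=> Oz Oy; rewrite leNgt; apply/negP => dd.
set a : R := 'd phi x (z - x) in dd; set b : R := 'd phi x (y - x) in dd.
have [t t01 tab] := sign_change dd.
have := interior_transverse (interior_segment Omega_convex Oy Oz t01).
rewrite (_ : _ - x = (1 - t) *: (y - x) + t *: (z - x)); last first.
  by apply/rowP => i; rewrite !mxE; ring.
by rewrite dphi_comb -/a -/b tab eqxx.
Qed.

(** The feasible directions at [x] form a convex cone which contains a
neighbourhood of [z - x] and, by [boundary_tangent], directions arbitrarily
close to any tangent one; adding the two fills the open half-space. *)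
Lemma feasible_side z v : interior Omega z ->
  0 < 'd phi x (z - x) * 'd phi x v ->
  exists2 t : R, 0 < t & Omega (x + t *: v).
Proof.
move=> Oz dd; have dz := interior_transverse Oz.
pose a := 'd phi x v / 'd phi x (z - x).
have a0 : 0 < a.
  rewrite (_ : a = 'd phi x (z - x) * 'd phi x v / 'd phi x (z - x) ^+ 2).
    by rewrite divr_gt0// exprn_even_gt0.
  rewrite /a; move: dz; set p : R := 'd phi x (z - x).
  by set q : R := 'd phi x v; clearbody p q => p0; field.
(* [v] is [a (z - x)] plus a tangent part [k]; tilting [k] by [s w] to reach the
   boundary is compensated by moving [z] by [- (s / a) w]. *)
pose k := v - a *: (z - x).
have dk : 'd phi x k = 0.
  by rewrite linearB linearZ/= /GRing.scale/= divfK ?subrr.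
case: phiP => _ _ [w dw] _.
have [e e0 eO] := open_line w Oz.
have ae0 : 0 < a * e by exact: mulr_gt0.
have [t [s [/andP[t0 t1] se /bO Oy]]] := boundary_tangent dk dw ae0.
have Oy' : Omega (z + (- (s / a)) *: w).
  apply: eO; rewrite normrN normrM normfV (gtr0_norm a0) ler_pdivrMr//.
  by rewrite mulrC.
pose c := 1 + t * a.
have c0 : 0 < c by rewrite /c addr_gt0// mulr_gt0.
(* Scaling [v = (k + s w) + a (z - (s / a) w - x)] by [t / c] turns it into a
   convex combination of the two points just found, with weights [1 / c] and
   [t a / c]. *)
exists (t / c); first exact: divr_gt0.
have t1' : 0 <= t * a / c <= 1.
  rewrite divr_ge0 ?(ltW c0)//= ?ler_pdivrMr// ?mul1r /c ?lerDr//.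
  by rewrite mulr_ge0 ?ltW.
have := convex_segment Omega_convex Oy Oy' t1'; congr Omega.
apply/rowP => i; rewrite /k !mxE /c; field.
by rewrite (gt_eqF a0) -/c (gt_eqF c0).
Qed.

End LocalEquation.

(** The feasible directions at [x] lie between the open and the closed
half-space bounded by the hyperplane orthogonal to [j]: the consequence of the
C^1 boundary on which everything else relies, free of local equations. *)
Definition smooth_normal {R : realType} {n : nat} (Omega : set 'rV[R]_n) x j :=
  [/\ dotv j j = 1,
      forall y, Omega y -> dotv j (y - x) <= 0
    & forall v, dotv j v < 0 -> exists2 t : R, 0 < t & Omega (x + t *: v)].

Section Normal.
Context {R : realType} {n : nat}.
Variable Omega : set 'rV[R]_n.
Hypothesis Omega_convex : convex_set Omega.
Hypothesis Omega_full_dim : interior Omega !=set0.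
Hypothesis Omega_closed : closed Omega.
Implicit Types (x y u v j : 'rV[R]_n).

Lemma boundary_sub : boundary Omega `<=` Omega.
Proof. by move=> x [/Omega_closed]. Qed.

Lemma local_equation_normal x U phi :
  boundary Omega x -> local_equation Omega x U phi ->
  exists2 j, smooth_normal Omega x j &
             forall v, dotv j v = 0 <-> 'd phi x v = 0.
Proof.
move=> bx phiP; have Ox := boundary_sub bx.
have [z Oz] := Omega_full_dim.
pose b : 'rV[R]_n := \row_i 'd phi x 'e_i.
have bE v : 'd phi x v = dotv b v :> R by exact: linear_dotv.
have b0 : 0 < enorm b.
  rewrite lt_neqAle enorm_ge0 eq_sym enorm_eq0 andbT; apply/eqP => b0.
  case: phiP => _ _ [w]; rewrite bE b0 dotvC dotv0r eqxx//.
have D0 := interior_transverse phiP bx Omega_convex Ox Oz.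
set D : R := 'd phi x (z - x) in D0.
have D0' : 0 < `|D| by rewrite normr_gt0.
(* The gradient [b], normalised, with the sign opposite to that of [D] so that
   interior points are on the negative side. *)
pose c := (`|D| * enorm b)^-1.
have c0 : 0 < c by rewrite invr_gt0 mulr_gt0.
exists ((- (D * c)) *: b); last first.
  move=> v; rewrite dotvZl bE; split => [/eqP|->]; last by rewrite mulr0.
  by rewrite mulf_eq0 oppr_eq0 mulf_eq0 (negbTE D0) (gt_eqF c0) => /eqP.
have jE v : dotv ((- (D * c)) *: b) v = - (c * (D * 'd phi x v)).
  by rewrite dotvZl bE; ring.
split=> [|y Oy|v].
- rewrite dotvZl dotvZr -enorm_sq /c invfM.
  have DD : D ^+ 2 = `|D| ^+ 2 by rewrite real_normK// num_real.
  rewrite (_ : _ * _ = D ^+ 2 * ((`|D|^-1) ^+ 2) * (enorm b / enorm b) ^+ 2).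
    rewrite divff ?gt_eqF// DD expr1n mulr1 -exprMn divff ?gt_eqF//.
    by rewrite expr1n.
  by ring.
- rewrite jE oppr_le0 mulr_ge0 ?(ltW c0)//.
  exact: (interior_side phiP bx Omega_convex Ox Oz Oy).
- rewrite jE oppr_lt0 pmulr_rgt0//.
  exact: (feasible_side phiP bx Omega_convex Ox boundary_sub Oz).
Qed.

Lemma closure_open_halfspace j v : dotv j j = 1 -> dotv j v <= 0 ->
  closure [set w | dotv j w < 0] v.
Proof.
move=> j1 jv B Bv.
have [e e0 eB] := open_line (- j) Bv.
exists (v + e *: - j); split; last by apply: eB; rewrite gtr0_norm.
by rewrite /= !dotvE j1; lra.
Qed.

Lemma closed_halfspace j : closed [set w | dotv j w <= 0].
Proof.
apply: (@preimage_closed _ _ (dotv j) [set r : R | r <= 0]) => [v _|].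
  exact: dotv_continuous.
exact: closed_le.
Qed.

Lemma tangent_cone_halfspace x j v : Omega x -> smooth_normal Omega x j ->
  tangent_cone Omega x v <-> dotv j v <= 0.
Proof.
move=> Ox [j1 jO jv]; split.
  move=> Tv; apply: (@closed_halfspace j); move: Tv.
  apply: closureS => _ [t [y [t0 Oy ->]]].
  by rewrite /= dotvZr mulr_ge0_le0// jO.
move/(closure_open_halfspace j1); apply: closureS => w /= /jv[t t0 Ot].
exists t^-1, (x + t *: w); split=> //; first by rewrite invr_ge0 ltW.
by rewrite addrAC subrr add0r scalerA mulVf ?scale1r// gt_eqF.
Qed.

(** Both half-spaces are the tangent cone, so their bounding hyperplanes agree;
this makes the tangent hyperplane independent of the local equation. *)
Lemma smooth_normal_ker x j j' v : Omega x ->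
  smooth_normal Omega x j -> smooth_normal Omega x j' ->
  dotv j' v = 0 -> dotv j v = 0.
Proof.
move=> Ox jP j'P j'v; apply/eqP; rewrite eq_le -[0 <= _]oppr_le0 -dotvNr.
by apply/andP; split; apply/(tangent_cone_halfspace _ Ox jP);
  apply/(tangent_cone_halfspace _ Ox j'P); rewrite ?dotvNr j'v ?oppr0.
Qed.

Lemma smooth_normal_outward x j : boundary Omega x ->
  smooth_normal Omega x j -> is_outward_normal Omega x j.
Proof.
move=> bx jP; have Ox := boundary_sub bx; split.
- by case: jP => j1 _ _; rewrite /enorm j1 sqrtr1.
- move=> v [U [phi [phiP dv]]].
  have [j' j'P j'v] := local_equation_normal bx phiP.
  by apply: (smooth_normal_ker Ox jP j'P); apply/j'v.
- near=> t => Ot; have t0 : 0 < t by near: t; exact: nbhs_right_gt.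
  case: jP => j1 /(_ _ Ot) + _.
  by rewrite addrAC subrr add0r dotvZr j1 mulr1 leNgt t0.
Unshelve. all: by end_near. Qed.

(** Orthogonality to [ker dphi] and unit length leave only [j] and [- j], and
[- j] is feasible, so it does not leave [Omega]. *)
Lemma outward_normalE x j U phi : boundary Omega x ->
  local_equation Omega x U phi ->
  smooth_normal Omega x j -> outward_normal Omega x = j.
Proof.
move=> bx phiP jP; have Ox := boundary_sub bx.
rewrite /outward_normal; case: xgetP => [j' _ [j'1 j'ker j'out]|]; last first.
  by move/(_ j); case; exact: smooth_normal_outward.
have [j0 j0P j0v] := local_equation_normal bx phiP.
have [j1 jO jfeas] := jP.
have j'E : j' = dotv j j' *: j.
  apply: orthogonal_hyperplane => // v jv; apply: j'ker.
  exists U, phi; split=> //; apply/j0v.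
  exact: (smooth_normal_ker Ox j0P jP).
have : dotv j j' ^+ 2 == 1.
  have : dotv j' j' = 1 by rewrite -enorm_sq j'1 expr1n.
  by rewrite {1 2}j'E dotvZl dotvZr j1 mulr1 -expr2 => ->.
rewrite sqrf_eq1 => /orP[/eqP jj'|/eqP jj']; first by rewrite j'E jj' scale1r.
have [|t t0 Ot] := jfeas j'; first by rewrite jj' oppr_lt0.
exfalso; suff : \forall t \near (0 : R)^'+, False by move/filter_ex => [].
near=> s.
have s0 : 0 < s by near: s; exact: nbhs_right_gt.
have st : s < t by near: s; exact: nbhs_right_lt.
suff : Omega (x + s *: j') by near: s; exact: j'out.
have /(convex_segment Omega_convex Ox Ot) : 0 <= s / t <= 1.
  by rewrite divr_ge0 ?(ltW s0) ?(ltW t0)//= ler_pdivrMr// mul1r ltW.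
by congr Omega; rewrite addrAC subrr add0r scalerA divfK ?gt_eqF.
Unshelve. all: by end_near. Qed.

Lemma outward_normalP x : C1_boundary Omega -> boundary Omega x ->
  smooth_normal Omega x (outward_normal Omega x).
Proof.
move=> C1 bx; have [U [phi phiP]] := C1 _ bx.
have [j jP _] := local_equation_normal bx phiP.
by rewrite (outward_normalE bx phiP jP).
Qed.

End Normal.

(** * Tangent cones and the slope denominator *)

Section Cones.
Context {R : realType} {n : nat}.
Variable Omega : set 'rV[R]_n.
Implicit Types (x y v g j : 'rV[R]_n).

Lemma tangent_cone0 x : Omega x -> tangent_cone Omega x 0.
Proof.
by move=> Ox; apply: subset_closure; exists 0, x; rewrite scale0r.
Qed.

Lemma tangent_cone_interior x v : interior Omega x -> tangent_cone Omega x v.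
Proof.
move=> Ox; have [e e0 /(_ e)] := open_line v Ox.
rewrite gtr0_norm// => /(_ (lexx _)) Oe.
apply: subset_closure; exists e^-1, (x + e *: v); split=> //.
  by rewrite invr_ge0 ltW.
by rewrite addrAC subrr add0r scalerA mulVf ?scale1r// gt_eqF.
Qed.

Lemma pi_norm_tangent x g :
  tangent_cone Omega x g -> pi_norm Omega x g = enorm g.
Proof.
move=> Tg; rewrite /pi_norm (projE Tg)// => q _.
by rewrite subrr dotvC dotv0r.
Qed.

Lemma pi_norm_normal x g : Omega x -> normal_cone Omega x g ->
  pi_norm Omega x g = 0.
Proof.
move=> Ox Ng; rewrite /pi_norm (projE (tangent_cone0 Ox)) => [|q Tq].
  by apply/eqP; rewrite enorm_eq0.
rewrite !subr0; apply: (@closed_halfspace _ _ g); move: q Tq.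
apply: closureS => _ [t [y [t0 Oy ->]]] /=.
by rewrite dotvZr mulr_ge0_le0// Ng.
Qed.

Lemma interior_tangent_cone x j v : Omega x -> smooth_normal Omega x j ->
  dotv j v < 0 -> interior (tangent_cone Omega x) v.
Proof.
move=> Ox jP jv.
have op : open [set w | dotv j w < 0].
  apply: (@open_comp _ _ (dotv j) [set r : R | r < 0]) => [w _|].
    exact: dotv_continuous.
  exact: open_lt.
have sub : [set w | dotv j w < 0] `<=` tangent_cone Omega x.
  by move=> w /= /ltW /(tangent_cone_halfspace _ Ox jP).
by move: v jv; rewrite -[forall v, _]/(_ `<=` _) -open_subsetE.
Qed.

End Cones.

(** * The retraction arc at a boundary point *)

Section BoundaryPoint.
Context {R : realType} {n : nat}.
Variable Omega : set 'rV[R]_n.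
Hypothesis Omega_compact : compact Omega.
Hypothesis Omega_convex : convex_set Omega.
Variables x g : 'rV[R]_n.
Hypothesis Ox : Omega x.
Local Notation j := (outward_normal Omega x).
Hypothesis jP : smooth_normal Omega x j.
Hypothesis g_out : 0 <= dotv j g.
Local Notation gt := (tangent_part Omega x g).
Hypothesis gt_neq0 : gt != 0.
Variable tau : R.
Hypothesis tau01 : 0 < tau < 1.

Let jj : dotv j j = 1. Proof. by case: jP. Qed.

Let gE : g = gt + dotv j g *: j.
Proof. by rewrite /tangent_part /normal_part dotvC subrK. Qed.

Let jgt : dotv j gt = 0.
Proof. by rewrite /tangent_part /normal_part !dotvE jj (dotvC g); ring. Qed.

Let gtj : dotv gt j = 0. Proof. by rewrite dotvC. Qed.

Let gt_gt0 : 0 < dotv gt gt.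
Proof. by rewrite lt_neqAle dotv_ge0 andbT eq_sym dotv_eq0. Qed.

Let ngt_gt0 : 0 < enorm gt.
Proof. by rewrite sqrtr_gt0. Qed.

(** As [h = <g, j> >= 0], the residual [g - gt = h j] lies in the normal
cone. *)
Lemma pi_norm_outside : pi_norm Omega x g = enorm gt.
Proof.
rewrite /pi_norm (@projE _ _ (tangent_cone Omega x) g gt)// => [|q Tq].
  by apply/(tangent_cone_halfspace _ Ox jP); rewrite jgt.
have /(tangent_cone_halfspace _ Ox jP) jq := Tq.
rewrite {1}gE addrAC subrr add0r dotvZl dotvDr dotvNr jgt subr0.
by rewrite mulr_ge0_le0.
Qed.

Definition arc_dir (lam gam : R) : 'rV[R]_n := lam *: gt - gam *: j.

Lemma arc_pointE lam gam :
  x + lam *: gt - gam *: j = x + arc_dir lam gam.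
Proof. by rewrite /arc_dir; move: gt => v; rewrite addrA. Qed.

Lemma sor_dirE lam gam :
  retraction Omega x (lam *: gt) = x + lam *: gt - gam *: j ->
  sor_dir Omega x g lam = arc_dir lam gam.
Proof.
by rewrite /sor_dir => ->; rewrite arc_pointE addrAC subrr add0r.
Qed.

Lemma arc_dirZ s lam gam : arc_dir (s * lam) (s * gam) = s *: arc_dir lam gam.
Proof. by rewrite /arc_dir; move: gt => v; rewrite scalerBr !scalerA. Qed.

Lemma dotv_arc_dir w lam gam :
  dotv w (arc_dir lam gam) = lam * dotv w gt - gam * dotv w j.
Proof. by rewrite /arc_dir dotvDr dotvNr [in LHS]dotvZr [in LHS]dotvZr. Qed.

Lemma arc_dir_sq lam gam :
  dotv (arc_dir lam gam) (arc_dir lam gam) = lam ^+ 2 * dotv gt gt + gam ^+ 2.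
Proof.
rewrite dotv_arc_dir !(dotvC (arc_dir _ _)) !dotv_arc_dir jj jgt gtj; ring.
Qed.

Lemma arc_dir_slope lam gam :
  dotv g (arc_dir lam gam) = lam * dotv gt gt - gam * dotv j g.
Proof.
have ggt : dotv g gt = dotv gt gt.
  have /= -> := congr1 (fun v => dotv v gt) gE.
  by rewrite dotvDl dotvZl jgt mulr0 addr0.
by rewrite dotv_arc_dir ggt (dotvC g).
Qed.

(** The slope condition on a point [x + d] of [Omega] in the half-plane of the
retraction arc, where [gam] need not be the least value reaching [Omega]. This
relaxation makes the set of pairs closed and stable under shrinking. *)
Definition admissible (lam gam : R) : Prop :=
  [/\ 0 <= gam, Omega (x + arc_dir lam gam)
    & tau * (enorm gt * enorm (arc_dir lam gam)) <= dotv g (arc_dir lam gam)].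

Lemma admissible_scale lam gam s : 0 <= s <= 1 ->
  admissible lam gam -> admissible (s * lam) (s * gam).
Proof.
move=> /andP[s0 s1] [gam0 Od sl].
split; rewrite ?arc_dirZ; first exact: mulr_ge0.
  have /(convex_segment Omega_convex Ox Od) : 0 <= s <= 1 by rewrite s0.
  by rewrite addrAC subrr add0r.
by rewrite enormZ// dotvZr [_ * (s * _)]mulrCA [tau * _]mulrCA ler_wpM2l.
Qed.

Lemma retraction_exists lam gam : 0 <= gam -> Omega (x + arc_dir lam gam) ->
  retraction_defined Omega x (lam *: gt).
Proof.
move=> gam0 Od.
pose A := `[0, gam] `&` [set r : R | Omega (x + lam *: gt + r *: (- j))].
have lineE r : x + lam *: gt + r *: - j = x + lam *: gt - r *: j.
  by rewrite scalerN.
have Agam : A gam.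
  by split; rewrite /= ?in_itv/= ?gam0 ?lexx// lineE arc_pointE.
have Ac : compact A.
  apply: compact_closedI; first exact: segment_compact.
  apply: (@preimage_closed _ _ (fun r : R => x + lam *: gt + r *: (- j)) Omega).
    by move=> r _; exact: line_continuous.
  exact: compact_closed.
have [c] := @compact_EVT_min _ R (fun r => r : R) A (ex_intro _ _ Agam) Ac
  (continuous_subspaceT (fun r : R => cvg_id)).
rewrite inE => -[]; rewrite /= in_itv/= lineE => /andP[c0 cgam] Oc cmin.
exists (x + lam *: gt - c *: j), c; split=> // r r0 Or.
have [rgam|/ltW] := leP r gam; last exact: le_trans.
by apply: cmin; rewrite inE; split; rewrite /= ?in_itv/= ?r0// lineE.
Qed.

(** Shrinking [gam] to its least feasible value increases the numerator
[<g, d>], since [<g, j> >= 0], and decreases the norm of [d]: the first hit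
inherits the slope bound of any other point of its line. *)
Lemma admissible_slope lam gam : 0 < lam -> admissible lam gam ->
  [/\ retraction_defined Omega x (lam *: gt),
      pi_norm Omega x g * enorm (sor_dir Omega x g lam) != 0
    & tau <= slope Omega x g (sor_dir Omega x g lam)].
Proof.
move=> lam0 [gam0 Od sl].
have rd := retraction_exists gam0 Od.
have [c [c0 pE Oc cmin]] := xgetPex x rd.
have dE := sor_dirE pE.
have cgam : c <= gam by apply: cmin => //; rewrite arc_pointE.
have d0 : 0 < enorm (arc_dir lam c).
  rewrite sqrtr_gt0 arc_dir_sq ltr_pwDl ?sqr_ge0// mulr_gt0//.
  exact: exprn_gt0.
rewrite dE /slope pi_norm_outside; split=> //.
  by rewrite mulf_neq0// gt_eqF.
rewrite ler_pdivlMr ?mulr_gt0//.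
apply: (@le_trans _ _ (tau * (enorm gt * enorm (arc_dir lam gam)))).
  have /andP[/ltW tau0 _] := tau01.
  rewrite ler_wpM2l// ler_wpM2l ?enorm_ge0// enorm_le !arc_dir_sq lerD2l.
  by rewrite lerXn2r// nnegrE.
apply: le_trans sl _; rewrite !arc_dir_slope lerD2l lerN2.
by rewrite ler_wpM2r.
Qed.

(** The retraction itself is an admissible point. *)
Lemma slope_admissible lam : retraction_defined Omega x (lam *: gt) ->
  pi_norm Omega x g * enorm (sor_dir Omega x g lam) != 0 ->
  tau <= slope Omega x g (sor_dir Omega x g lam) ->
  exists gam, admissible lam gam.
Proof.
move=> rd; have [c [c0 pE Oc _]] := xgetPex x rd.
have dE := sor_dirE pE.
rewrite dE /slope pi_norm_outside => d0 sl; exists c; split=> //.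
  by rewrite -arc_pointE -pE.
rewrite -ler_pdivlMr//.
by rewrite lt_neqAle eq_sym d0 mulr_ge0 ?enorm_ge0.
Qed.

(** Smoothness: for small [r > 0] the direction [gt - r j] points strictly
inside, hence is feasible, and its slope tends to [1 > tau] as [r] tends to 0;
[r] is chosen from the bound [|gt - r j| <= |gt| + r]. *)
Lemma admissible_positive : exists lam gam, 0 < lam /\ admissible lam gam.
Proof.
have /andP[tau0 tau1] := tau01.
pose h := dotv j g; pose N := enorm gt.
have N0 : 0 < N by [].
pose r := N ^+ 2 * (1 - tau) / (h + N).
have hN : 0 < h + N by rewrite ltr_wpDl.
have r0 : 0 < r by rewrite divr_gt0// mulr_gt0 ?subr_gt0// exprn_gt0.
have [_ _ feas] := jP.
have [|t t0 Ot] := feas (arc_dir 1 r).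
  by rewrite dotv_arc_dir jj jgt; lra.
exists (t * 1), (t * r); split; first by rewrite mulr1.
split; rewrite ?arc_dirZ//; first by rewrite mulr_ge0// ltW.
rewrite enormZ ?(ltW t0)// dotvZr [_ * (t * _)]mulrCA [tau * _]mulrCA.
rewrite ler_pM2l// arc_dir_slope -enorm_sq mul1r -/N -/h.
have dN : enorm (arc_dir 1 r) <= N + r.
  rewrite -[leRHS]gtr0_norm ?addr_gt0// -sqrtr_sqr ler_wsqrtr//.
  rewrite arc_dir_sq -enorm_sq -/N.
  by have := mulr_ge0 (ltW N0) (ltW r0); rewrite !expr2; lra.
apply: (@le_trans _ _ (tau * (N * (N + r)))).
  by rewrite ler_pM2l// ler_pM2l.
have rE : r * (h + N) = N ^+ 2 * (1 - tau) by rewrite /r divfK// gt_eqF.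
have : tau * (N * r) <= N * r by rewrite ger_pMl ?ltW// mulr_gt0.
by move: rE; rewrite !expr2; lra.
Qed.

(** The directions [d] of admissible pairs are those with [x + d] in [Omega]
that lie in the plane of [gt] and [j] and satisfy the closed slope condition;
then [gam = - <j, d> >= 0] because [j] supports [Omega]. On this compact set
[<gt, d> = lam |gt|^2] attains its maximum. *)
Lemma admissible_max : exists lam, (exists gam, admissible lam gam) /\
  forall lam' gam', admissible lam' gam' -> lam' <= lam.
Proof.
pose P : set 'rV[R]_n := \bigcap_(w in [set w | dotv gt w = 0 /\ dotv j w = 0])
  [set d | dotv w d = 0].
pose Q := [set d : 'rV[R]_n | tau * (enorm gt * enorm d) - dotv g d <= 0].
have Pcl : closed P.
  apply: closed_bigI => w _.
  apply: (@preimage_closed _ _ (dotv w) [set r : R | r = 0]) => [v _|].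
    exact: dotv_continuous.
  exact: closed_eq.
have Qcl : closed Q.
  apply: (@preimage_closed _ _
    (fun d => tau * (enorm gt * enorm d) - dotv g d) [set r : R | r <= 0]).
    move=> v _; apply: (@continuousB R R 'rV[R]_n); last exact: dotv_continuous.
    apply: (@continuousM R 'rV[R]_n); first exact: cst_continuous.
    apply: (@continuousM R 'rV[R]_n); first exact: cst_continuous.
    exact: enorm_continuous.
  exact: closed_le.
pose K := Omega `&` [set y | (P `&` Q) (y - x)].
have Kc : compact K.
  apply: compact_closedI => //.
  apply: (@preimage_closed 'rV[R]_n 'rV[R]_n (fun y : 'rV[R]_n => y - x)
    (P `&` Q)).
    by move=> y _; exact: translation_continuous.
  exact: closedI.
have admK lam gam : admissible lam gam -> K (x + arc_dir lam gam).
  move=> [_ Od sl]; split=> //=.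
  rewrite addrAC subrr add0r; split; last by rewrite /Q/= subr_le0.
  move=> w [gtw jw] /=.
  by rewrite dotv_arc_dir !(dotvC w) gtw jw !mulr0 subr0.
have [l0 [c0 [_ /admK K0]]] := admissible_positive.
have fc : continuous (fun y : 'rV[R]_n => dotv gt (y - x)).
  move=> y; apply: (@continuous_comp 'rV[R]_n 'rV[R]_n R
    (fun y : 'rV[R]_n => y - x) (dotv gt)).
    exact: translation_continuous.
  exact: dotv_continuous.
have [y] :=
  @compact_EVT_max _ R _ K (ex_intro _ _ K0) Kc (continuous_subspaceT fc).
rewrite inE => -[Oy] /= [Py Qy] ymax.
pose d := y - x; pose lam := dotv gt d / dotv gt gt; pose gam := - dotv j d.
have gt1 : dotv gt gt != 0 by rewrite gt_eqF.
have dE : d = arc_dir lam gam.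
  apply/eqP; rewrite -subr_eq0 -dotv_eq0; set r := d - _.
  have gtr : dotv gt r = 0.
    by rewrite /r dotvDr dotvNr dotv_arc_dir gtj /lam divfK// mulr0 subr0 subrr.
  have jr : dotv j r = 0.
    by rewrite /r dotvDr dotvNr dotv_arc_dir jgt jj /gam; ring.
  rewrite {2}/r dotvDr dotvNr (Py r (conj gtr jr)) dotv_arc_dir.
  by rewrite !(dotvC r) gtr jr !mulr0 subr0 subr0.
exists lam; split.
  exists gam; split; rewrite -?dE.
  - by case: jP => _ /(_ _ Oy) + _; rewrite oppr_ge0.
  - by rewrite addrC subrK.
  - by rewrite -subr_le0.
move=> lam' gam' /admK/mem_set/ymax.
rewrite (addrAC x) subrr add0r dotv_arc_dir gtj.
by rewrite mulr0 subr0 -ler_pdivlMr.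
Qed.

Let S := [set lam |
  [/\ 0 <= lam,
      retraction_defined Omega x (lam *: gt),
      pi_norm Omega x g * enorm (sor_dir Omega x g lam) != 0
    & tau <= slope Omega x g (sor_dir Omega x g lam)]].

Lemma nubar_gt0 : 0 < nubar Omega tau x g.
Proof.
have [lam [gam [lam0 adm]]] := admissible_positive.
have [lamM [_ lamM_ub]] := admissible_max.
have [rd d0 sl] := admissible_slope lam0 adm.
apply: (lt_le_trans lam0); apply: (@ub_le_sup _ S); last first.
  by split=> //; exact: ltW.
exists lamM => l [_ rdl dl0 sll].
by have [c /lamM_ub] := slope_admissible rdl dl0 sll.
Qed.

Lemma nubar_slope lam : 0 < lam <= nubar Omega tau x g ->
  tau <= slope Omega x g (sor_dir Omega x g lam).
Proof.
move=> /andP[lam0 lamn].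
have [l0 [c0 [l00 adm0]]] := admissible_positive.
have [lamM [[gam admM] lamM_ub]] := admissible_max.
have [rd0 d0 sl0] := admissible_slope l00 adm0.
have lamM0 : 0 < lamM by rewrite (lt_le_trans l00)// (lamM_ub _ _ adm0).
have lam_le : lam <= lamM.
  apply: (le_trans lamn); apply: (@ge_sup _ S).
    by exists l0; split=> //; exact: ltW.
  move=> l [_ rdl dl0 sll].
  by have [c /lamM_ub] := slope_admissible rdl dl0 sll.
have s01 : 0 <= lam / lamM <= 1.
  by rewrite divr_ge0 ?(ltW lam0) ?(ltW lamM0)//= ler_pdivrMr// mul1r.
have := admissible_scale s01 admM; rewrite divfK ?gt_eqF// => adm.
by have [] := admissible_slope lam0 adm.
Qed.

End BoundaryPoint.

(** * The slope bound *)

Theorem proposition6p5 (R : realType) (n : nat) (Omega : set 'rV[R]_n) (tau : R)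
  (Omega_compact : compact Omega)
  (Omega_convex : convex_set Omega)
  (Omega_full_dim : interior Omega !=set0)
  (Omega_C1 : C1_boundary Omega)
  (tau01 : 0 < tau < 1) :
  tau <= SB Omega tau.
Proof.
have [z Oz] := Omega_full_dim.
apply: lb_le_inf.
  by exists (DSB Omega tau z 0); exists z; [exact: interior_subset|exists 0].
move=> _ [x Ox [g _ <-]]; rewrite /DSB.
have /andP[_ tau1] := tau01.
case: ifPn => [pi0|_]; last exact: ltW.
have [gint|gint] := pselect (interior (tangent_cone Omega x) g).
  have Tg := interior_subset gint.
  apply: lb_le_inf; first by exists (slope Omega x g g), g => //; constructor 1.
  move=> _ [d [[_ ->]|[[_ Tg0] _]|[pi1 _]] <-]; last 2 first.
  - by exfalso; apply: Tg0; left.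
  - by rewrite pi1 eqxx in pi0.
  rewrite (pi_norm_tangent Tg) in pi0.
  rewrite /slope (pi_norm_tangent Tg) -enorm_sq -expr2 divff ?expf_neq0//.
  exact: ltW.
have Omega_closed : closed Omega by apply: compact_closed.
have bx : boundary Omega x.
  split; first exact: subset_closure.
  move=> Oix; apply: gint.
  by rewrite (_ : tangent_cone Omega x = setT) ?interiorT// -subTset => v _;
    exact: tangent_cone_interior.
have jP := outward_normalP Omega_convex Omega_full_dim Omega_closed Omega_C1 bx.
have g_out : 0 <= dotv (outward_normal Omega x) g.
  by rewrite leNgt; apply/negP => /(interior_tangent_cone Ox jP).
have gt0 : tangent_part Omega x g != 0.
  by rewrite -enorm_eq0 -(pi_norm_outside Ox jP g_out).
have nu0 := nubar_gt0 Omega_compact Ox jP g_out gt0 tau01.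
have nuP := nubar_slope Omega_compact Omega_convex Ox jP g_out gt0 tau01.
have Tb : Tbar Omega x g.
  split=> // -[//|/(pi_norm_normal Ox) pi1].
  by rewrite pi1 eqxx in pi0.
apply: lb_le_inf.
  exists (slope Omega x g (sor_dir Omega x g (nubar Omega tau x g))).
  exists (sor_dir Omega x g (nubar Omega tau x g)) => //.
  by constructor 2; split=> //; exists (nubar Omega tau x g); rewrite nu0 lexx.
move=> _ [d [[//]|[_ [lam [lam01 ->]]]|[pi1 _]] <-]; first exact: nuP.
by rewrite pi1 eqxx in pi0.
Qed.
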